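(* Let $(P,d)$ be a metric space, let $\mathbb X$ and $\mathbb Y$ be normed spaces, let $f:P\times\mathbb X\to\mathbb Y$ be a mapping and $T:\mathbb X\rightrightarrows\mathbb Y$ a set-valued mapping, and let $$S_{f,T}(p)=\{x\in\mathbb X:\ \mathbf 0\in f(p,x)+T(x)\},\quad p\in P.$$ Let $\bar p\in P$, $\bar x\in S_{f,T}(\bar p)$ and $\epsilon>0$. Suppose that: (i) $f(\cdot,\bar x)$ is calm at $\bar p$ with modulus $\mathrm{clm}\,f(\cdot,\bar x)(\bar p)$; (ii) $f$ admits a partial outer $\epsilon$-prederivative $\mathcal A:\mathbb X\rightrightarrows\mathbb Y$ at $(\bar p,\bar x)$, uniformly with respect to $p$; (iii) the set-valued mapping $x\rightrightarrows f(\bar p,\bar x)+\mathcal A(x-\bar x)+T(x)$ is strongly metrically subregular at $(\bar x,\mathbf 0)$, with modulus denoted $\mathrm{subreg}\,(\mathcal A+T)(\bar x,\mathbf 0)$, such that $$\epsilon\cdot\mathrm{subreg}\,(\mathcal A+T)(\bar x,\mathbf 0)<1.$$ Then $S_{f,T}:P\rightrightarrows\mathbb X$ has the isolated calmness property at $(\bar p,\bar x)$ and $$\mathrm{clm}\,S_{f,T}(\bar p,\bar x)\le\frac{\mathrm{clm}\,f(\cdot,\bar x)(\bar p)\cdot\mathrm{subreg}\,(\mathcal A+T)(\bar x,\mathbf 0)}{1-\epsilon\cdot\mathrm{subreg}\,(\mathcal A+T)(\bar x,\mathbf 0)}.$$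
   Context: $B(x,r)$ denotes the closed ball with center $x$ and radius $r$, $\mathbb B$ the closed unit ball of a normed space, $\mathbf 0$ the null vector, and $\mathrm{dist}(x,S)=\inf_{s\in S}d(x,s)$, with $\mathrm{dist}(x,\varnothing)=+\infty$. For a set-valued mapping $F$, $\mathrm{graph}\,F=\{(x,y): y\in F(x)\}$ and $F^{-1}(y)=\{x: y\in F(x)\}$. A set-valued mapping $\mathcal A:\mathbb X\rightrightarrows\mathbb Y$ is positively homogeneous if $\mathbf 0\in\mathcal A(\mathbf 0)$ and $\mathcal A(tx)=t\mathcal A(x)$ for all $x\in\mathbb X$, $t>0$. A positively homogeneous $\mathcal A:\mathbb X\rightrightarrows\mathbb Y$ is a partial outer $\epsilon$-prederivative of $f:P\times\mathbb X\to\mathbb Y$ at $(\bar p,\bar x)$, uniformly with respect to $p$, if there exist $\delta,\zeta>0$ and a function $r:P\times\delta\mathbb B\to[0,\epsilon]$ such that $$f(p,x)\in f(p,\bar x)+\mathcal A(x-\bar x)+r(p,x-\bar x)\|x-\bar x\|\mathbb B,\quad\forall x\in B(\bar x,\delta),\ \forall p\in B(\bar p,\zeta).$$ A set-valued mapping $F:X\rightrightarrows Y$ between metric spaces is metrically subregular at $(\bar x,\bar y)\in\mathrm{graph}\,F$ if there exist $\kappa\ge 0$, $r>0$ such that $\mathrm{dist}(x,F^{-1}(\bar y))\le\kappa\,\mathrm{dist}(\bar y,F(x))$ for all $x\in B(\bar x,r)$; the modulus $\mathrm{subreg}\,F(\bar x,\bar y)$ is the infimum of all $\kappa\ge0$ for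 which such an $r$ exists. $F$ is strongly metrically subregular at $(\bar x,\bar y)$ if, in addition, $\bar x$ is an isolated point of $F^{-1}(\bar y)$; equivalently, if there exist $\kappa\ge0$, $r>0$ with $d(x,\bar x)\le\kappa\,\mathrm{dist}(\bar y,F(x))$ for all $x\in B(\bar x,r)$. A set-valued mapping $G:X\rightrightarrows Y$ between metric spaces is calm at $(\bar x,\bar y)\in\mathrm{graph}\,G$ if there exist $\kappa\ge0$, $r>0$ such that $$\sup_{y\in G(x)\cap B(\bar y,r)}\mathrm{dist}(y,G(\bar x))\le\kappa\,d(x,\bar x),\quad\forall x\in B(\bar x,r);$$ the calmness modulus $\mathrm{clm}\,G(\bar x,\bar y)$ is the infimum of all $\kappa\ge0$ for which such an $r$ exists. A single-valued mapping $g$ is called calm at $\bar x$ if, regarded as the set-valued mapping $x\mapsto\{g(x)\}$, it is calm in this sense at $(\bar x,g(\bar x))$, and its modulus is then written $\mathrm{clm}\,g(\bar x)$. $G$ has the isolated calmness property at $(\bar x,\bar y)$ if it is calm at $(\bar x,\bar y)$ and, in addition, $\bar y$ is an isolated point of $G(\bar x)$.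
   Formalization: The formal theorem also assumes that f(·,x̄) is continuous at p̄: the localized definition of calmness holds vacuously for a map that jumps away at p̄, and the claim then fails; with continuity, (i) is the usual calmness d(f(p,x̄),f(p̄,x̄)) ≤ κ d(p,p̄) near p̄, with the same modulus. *)

(* Defs.v *)
From HB Require Import structures.
From mathcomp Require Import all_boot all_order all_algebra.
From mathcomp Require Import all_classical all_reals all_analysis.
Set Implicit Arguments.
Unset Strict Implicit.
Unset Printing Implicit Defensive.
Import Order.TTheory GRing.Theory Num.Theory.
Import numFieldNormedType.Exports.
Local Open Scope classical_set_scope.
Local Open Scope ring_scope.

(* A set-valued mapping from X to Y is a function X -> set Y.  The metric
   notions are stated over pseudoMetricType, the common parent of metricType
   and normedModType, through the library's edist (the distance, as an extended
   real: mdist on a metricType, the norm of the difference on a normedModType)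
   and edist_inf A x (the distance from x to A, +oo when A is empty). *)

(* Not the library's closed_ball, which is the closure of the open ball and can
   be smaller than the ball below in a metric space. *)
Definition cball (R : realType) (X : pseudoMetricType R) (x : X) (r : R) :
  set X := [set y | (edist (x, y) <= r%:E)%E].

Definition unit_cball (R : realType) (Y : normedModType R) : set Y :=
  [set y | `|y| <= 1].

Definition set_add (Y : zmodType) (A B : set Y) : set Y :=
  [set a + b | a in A & b in B].

Definition set_scale (R : pzRingType) (Y : lmodType R) (t : R) (A : set Y) :
  set Y := [set t *: a | a in A].

Notation "A [+] B" := (set_add A B) (at level 50, left associativity)
  : classical_set_scope.
Notation "t [*:] A" := (set_scale t A) (at level 40, left associativity)
  : classical_set_scope.

Definition preimage_sv (X Y : Type) (F : X -> set Y) (y : Y) : set X :=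
  [set x | F x y].

(* When F x is empty the right-hand side is k * +oo, with 0 * +oo = 0 in the
   library; the choice of this convention affects neither the existence of an
   admissible k nor the infimum of the admissible k, because k = 0 may always
   be replaced by arbitrarily small k > 0. *)
Definition subreg_constant (R : realType) (X Y : pseudoMetricType R)
    (F : X -> set Y) (xbar : X) (ybar : Y) (k : R) : Prop :=
  0 <= k /\ exists r : R, 0 < r /\
    forall x, cball xbar r x ->
      (edist_inf (preimage_sv F ybar) x <= k%:E * edist_inf (F x) ybar)%E.

Definition metrically_subregular (R : realType) (X Y : pseudoMetricType R)
    (F : X -> set Y) (xbar : X) (ybar : Y) : Prop :=
  F xbar ybar /\ exists k : R, subreg_constant F xbar ybar k.

(* +oo when F is not metrically subregular. *)
Definition subreg (R : realType) (X Y : pseudoMetricType R)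
    (F : X -> set Y) (xbar : X) (ybar : Y) : \bar R :=
  ereal_inf [set k%:E | k in subreg_constant F xbar ybar].

Definition strongly_metrically_subregular (R : realType)
    (X Y : pseudoMetricType R) (F : X -> set Y) (xbar : X) (ybar : Y) : Prop :=
  metrically_subregular F xbar ybar /\ isolated (preimage_sv F ybar) xbar.

(* The supremum of the empty set is -oo, so that the inequality holds trivially
   when G x does not meet the ball. *)
Definition calm_constant (R : realType) (X Y : pseudoMetricType R)
    (G : X -> set Y) (xbar : X) (ybar : Y) (k : R) : Prop :=
  0 <= k /\ exists r : R, 0 < r /\
    forall x, cball xbar r x ->
      (ereal_sup [set edist_inf (G xbar) y | y in G x `&` cball ybar r]
         <= k%:E * edist (x, xbar))%E.

Definition calm (R : realType) (X Y : pseudoMetricType R)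
    (G : X -> set Y) (xbar : X) (ybar : Y) : Prop :=
  G xbar ybar /\ exists k : R, calm_constant G xbar ybar k.

(* +oo when G is not calm. *)
Definition clm (R : realType) (X Y : pseudoMetricType R)
    (G : X -> set Y) (xbar : X) (ybar : Y) : \bar R :=
  ereal_inf [set k%:E | k in calm_constant G xbar ybar].

Definition isolated_calm (R : realType) (X Y : pseudoMetricType R)
    (G : X -> set Y) (xbar : X) (ybar : Y) : Prop :=
  calm G xbar ybar /\ isolated (G xbar) ybar.

(* Because of the localization y \in cball ybar r, calm_fun does not imply
   continuity: a map jumping by more than r away from g xbar satisfies it
   vacuously.  When g is continuous at xbar, calm_fun and clm_fun amount to the
   usual bound on edist (g x, g xbar). *)
Definition calm_fun (R : realType) (X Y : pseudoMetricType R)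
    (g : X -> Y) (xbar : X) : Prop :=
  calm (fun x => [set g x]) xbar (g xbar).

Definition clm_fun (R : realType) (X Y : pseudoMetricType R)
    (g : X -> Y) (xbar : X) : \bar R :=
  clm (fun x => [set g x]) xbar (g xbar).

Definition positively_homogeneous (R : realType) (X Y : normedModType R)
    (A : X -> set Y) : Prop :=
  A 0 0 /\ forall (x : X) (t : R), 0 < t -> A (t *: x) = t [*:] A x.

(* Only the values of r on P x (delta B) matter, hence the bound there only. *)
Definition partial_outer_prederivative (R : realType) (P : metricType R)
    (X Y : normedModType R) (eps : R) (A : X -> set Y) (f : P * X -> Y)
    (pbar : P) (xbar : X) : Prop :=
  positively_homogeneous A /\
  exists delta zeta : R, exists r : P -> X -> R,
    [/\ 0 < delta, 0 < zeta,
        (forall p u, (delta [*:] unit_cball (Y := X)) u -> 0 <= r p u <= eps) &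
        (forall x p, cball xbar delta x -> cball pbar zeta p ->
          ([set f (p, xbar)] [+] A (x - xbar)
             [+] (r p (x - xbar) * `|x - xbar|) [*:] unit_cball (Y := Y))
          (f (p, x)))].

Definition solution_map (R : realType) (P : metricType R)
    (X Y : normedModType R) (f : P * X -> Y) (T : X -> set Y) : P -> set X :=
  fun p => [set x | ([set f (p, x)] [+] T x) 0].

Definition prederivative_map (R : realType) (P : metricType R)
    (X Y : normedModType R) (f : P * X -> Y) (A T : X -> set Y)
    (pbar : P) (xbar : X) : X -> set Y :=
  fun x => [set f (pbar, xbar)] [+] A (x - xbar) [+] T x.

(* Main.v *)
Require Import Defs.
From HB Require Import structures.
From mathcomp Require Import all_boot all_order all_algebra.
From mathcomp Require Import all_classical all_reals all_analysis.
From mathcomp Require Import lra.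
Import Order.TTheory GRing.Theory Num.Theory.
Import numFieldNormedType.Exports.
Local Open Scope classical_set_scope.
Local Open Scope ring_scope.

(** The isolated calmness of [S := solution_map f T] comes from one Lipschitz
    estimate at the reference point. Write [F] for [prederivative_map] and
    [g p := f (p, xbar)], and let [x \in S p] be close to [xbar], with [p] close
    to [pbar]. The prederivative splits [f (p, x)] as [g p + a + w] with
    [a \in A (x - xbar)] and [`|w| <= eps * `|x - xbar|]. Trading [g p] for
    [g pbar] and dropping [w] turns the inclusion [0 \in f (p, x) + T x] into
    [g pbar - g p - w \in F x]: up to a controlled error, [x] solves the
    inclusion [0 \in F x].

    Strong subregularity of [F] with constant [k] bounds [`|x - xbar|] by [k]
    times that error ([strong_subreg_bound]). Calmness of [g] with constant [l],
    made effective by continuity ([calm_fun_bound]), bounds the error by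
    [l * d (p, pbar) + eps * `|x - xbar|]. When [eps * k < 1] the last term is
    absorbed on the left, leaving
    [`|x - xbar| <= k * l / (1 - eps * k) * d (p, pbar)] ([solution_bound]).
    Both halves of isolated calmness follow: at [p = pbar] the bound forces
    [x = xbar], and [xbar \in S pbar] makes [k * l / (1 - eps * k)] a calmness
    constant of [S] ([calm_isolated_of_bound]).

    For the moduli, let [c] be the infimum of the calmness constants of [S].
    Clearing the denominator gives [c <= k * (l + eps * c)], whose right-hand
    side is affine and nondecreasing in [k] and in [l] separately, and which
    holds trivially when [eps * k >= 1]. It therefore passes to the infimum in each variable, and the
    denominator is restored at the end. *)

(** * Infima of constants *)

Lemma le_mul_inf (R : realType) (S : set R) (a b : R) :
  S !=set0 -> 0 <= b -> (forall s, S s -> a <= b * s) -> a <= b * inf S.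
Proof.
move=> [s0 Ss0]; rewrite le_eqVlt => /predU1P[<- h|b0 h].
  by have := h _ Ss0; rewrite !mul0r.
rewrite mulrC -ler_pdivrMr//; apply: lb_le_inf; first by exists s0.
by move=> s Ss; rewrite ler_pdivrMr// mulrC; exact: h.
Qed.

Lemma ereal_inf_EFin_ge0 (R : realType) (S : set R) :
  S !=set0 -> (forall s, S s -> 0 <= s) ->
  ereal_inf [set s%:E | s in S] = (inf S)%:E /\ 0 <= inf S.
Proof.
move=> S0 Sge0; split; last exact: lb_le_inf.
by apply: ereal_inf_EFin => //; exists 0.
Qed.

(** * Balls and extended distances *)

Lemma edist_normE (R : realType) (X : normedModType R) (x y : X) :
  edist (x, y) = `|x - y|%:E.
Proof.
apply/eqP; rewrite eq_le; apply/andP; split.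
  apply/lee_addgt0Pr => e e0; rewrite -EFinD; apply: edist_fin => /=.
    by rewrite ltr_wpDl.
  by rewrite -ball_normE /ball_ /= ltrDl.
apply: le_ereal_inf_tmp => _ [r [r0 /= xyr] <-].
by rewrite lee_fin ltW//; move: xyr; rewrite -ball_normE.
Qed.

Lemma cball_normE (R : realType) (X : normedModType R) (x y : X) (r : R) :
  cball x r y = (`|y - x| <= r) :> Prop.
Proof. by rewrite /cball /= edist_normE lee_fin distrC. Qed.

Lemma cball_le (R : realType) (X : pseudoMetricType R) (x : X) (r s : R) :
  r <= s -> cball x r `<=` cball x s.
Proof. by move=> rs y /= /le_trans; apply; rewrite lee_fin. Qed.

Lemma cball_center (R : realType) (X : pseudoMetricType R) (x : X) (r : R) :
  0 < r -> cball x r x.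
Proof. by move=> r0; rewrite /cball /= edist_refl lee_fin ltW. Qed.

Lemma nbhs_cballP (R : realType) (X : pseudoMetricType R) (x : X) (V : set X) :
  nbhs x V <-> exists r : R, 0 < r /\ cball x r `<=` V.
Proof.
split=> [/nbhs_ballP[r /= r0 rV]|[r [r0 rV]]].
  exists (r / 2); split; first by rewrite divr_gt0.
  move=> y /= xy; apply: rV; apply: (@edist_lt_ball _ _ _ (x, y)).
  by apply: (le_lt_trans xy); rewrite lte_fin; lra.
apply/nbhs_ballP; exists r => //= y xy; apply: rV.
exact: (@edist_fin _ _ _ (x, y)).
Qed.

(** The infimum is attained at [a] for points much closer to [a] than the rest
    of [S] is. *)
Lemma isolated_edist_inf (R : realType) (X : pseudoMetricType R)
    (S : set X) (a : X) :
  isolated S a -> exists r : R, 0 < r /\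
    forall x, cball a r x -> (edist (x, a) <= edist_inf S x)%E.
Proof.
move=> [_ [V /nbhs_cballP[r [r0 rV]] VS]].
(* Half the isolation radius: a point of S at distance at most r / 2 from x
   is within r of a, hence is a. *)
exists (r / 2); split; first by rewrite divr_gt0.
move=> x /= ax; apply: le_ereal_inf_tmp => _ [y Sy <-].
have [xy|xy] := leP (edist (x, y)) (r / 2)%:E; last first.
  by rewrite edist_sym; apply: le_trans ax (ltW xy).
suff : (V `&` S) y by rewrite VS => /= ->.
split => //; apply: rV; rewrite /cball /=.
apply: le_trans (edist_triangle a x y) _.
by apply: le_trans (leeD ax xy) _; rewrite -EFinD lee_fin; lra.
Qed.

(** * Pointwise bounds from the regularity properties *)

(** Near [xbar] the distance to the preimage is the distance to [xbar], so that
    subregularity becomes a bound by any single value of [F]. *)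
Lemma strong_subreg_bound (R : realType) (X Y : pseudoMetricType R)
    (F : X -> set Y) (xbar : X) (ybar : Y) (k : R) :
  isolated (preimage_sv F ybar) xbar -> subreg_constant F xbar ybar k ->
  exists r : R, 0 < r /\ forall x y, cball xbar r x -> F x y ->
    (edist (x, xbar) <= k%:E * edist (y, ybar))%E.
Proof.
move=> /isolated_edist_inf[r1 [r10 h1]] [k0 [r2 [r20 h2]]].
exists (Num.min r1 r2); split; first by rewrite lt_min r10.
move=> x y xr Fxy.
have xr1 : cball xbar r1 x by apply: cball_le xr; rewrite ge_min lexx.
have xr2 : cball xbar r2 x by apply: cball_le xr; rewrite ge_min lexx orbT.
apply: le_trans (h1 x xr1) _; apply: le_trans (h2 x xr2) _.
apply: lee_wpmul2l; first by rewrite lee_fin.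
by apply: ereal_inf_lbound; exists y => //; rewrite edist_sym.
Qed.

(** Continuity keeps [g p] in the ball to which the definition of calmness is
    localized. *)
Lemma calm_fun_bound (R : realType) (P Y : pseudoMetricType R) (g : P -> Y)
    (pbar : P) (l : R) :
  {for pbar, continuous g} ->
  calm_constant (fun p => [set g p]) pbar (g pbar) l ->
  exists r : R, 0 < r /\ forall p, cball pbar r p ->
    (edist (g p, g pbar) <= l%:E * edist (p, pbar))%E.
Proof.
move=> gc [l0 [r1 [r10 h1]]].
have /nbhs_cballP[r2 [r20 h2]] : nbhs pbar (g @^-1` cball (g pbar) r1).
  by apply: gc; apply/nbhs_cballP; exists r1; split.
exists (Num.min r1 r2); split; first by rewrite lt_min r10.
move=> p pr.
have pr1 : cball pbar r1 p by apply: cball_le pr; rewrite ge_min lexx.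
have pr2 : cball pbar r2 p by apply: cball_le pr; rewrite ge_min lexx orbT.
apply: le_trans (h1 p pr1); apply: ereal_sup_ubound; exists (g p).
  by split => //; exact: h2.
by rewrite /edist_inf image_set1 ereal_inf1.
Qed.

(** At [p = pbar] the right-hand side vanishes, which isolates [xbar]; for the
    other [p], [xbar] is a competitor in the distance from [x] to [G pbar]. *)
Lemma calm_isolated_of_bound (R : realType) (P : pseudoMetricType R)
    (X : normedModType R) (G : P -> set X) (pbar : P) (xbar : X) (k r : R) :
  G pbar xbar -> 0 <= k -> 0 < r ->
  (forall p x, cball pbar r p -> cball xbar r x -> G p x ->
     (edist (x, xbar) <= k%:E * edist (p, pbar))%E) ->
  calm_constant G pbar xbar k /\ isolated (G pbar) xbar.
Proof.
move=> Gx k0 r0 h; split.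
  split=> //; exists r; split=> // p pr.
  apply: ge_ereal_sup => _ [x [Gpx xr] <-].
  apply: le_trans (h p x pr xr Gpx).
  by apply: ereal_inf_lbound; exists xbar.
split; first exact/mem_set.
exists (cball xbar r); first by apply/nbhs_cballP; exists r; split.
apply/seteqP; split=> [x [xr Gpx]|_ ->] /=; last first.
  by split; first exact: cball_center.
have := h pbar x (cball_center _ _ _ _ r0) xr Gpx.
by rewrite edist_refl mule0 edist_normE lee_fin normr_le0 subr_eq0 => /eqP.
Qed.

(** * The estimate on solutions *)

(** The perturbation argument: [g pbar - g p - w] is a value of [F] at [x] whose
    norm is at most [l * d (p, pbar) + eps * `|x - xbar|]. *)
Lemma solution_bound (R : realType) (P : metricType R) (X Y : normedModType R)
    (f : P * X -> Y) (T : X -> set Y) (pbar : P) (xbar : X) (eps : R)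
    (A : X -> set Y) (k l : R) :
  let F := prederivative_map f A T pbar xbar in
  let g := fun p => f (p, xbar) in
  {for pbar, continuous g} ->
  calm_constant (fun p => [set g p]) pbar (g pbar) l ->
  partial_outer_prederivative eps A f pbar xbar ->
  isolated (preimage_sv F 0) xbar -> subreg_constant F xbar 0 k ->
  eps * k < 1 ->
  exists r : R, 0 < r /\
    forall p x, cball pbar r p -> cball xbar r x -> solution_map f T p x ->
    (edist (x, xbar) <= (k * l / (1 - eps * k))%:E * edist (p, pbar))%E.
Proof.
move=> F g gc lg [_ [delta [zeta [rho [delta0 zeta0 rhoP fA]]]]] isoF kF ek.
have [r1 [r10 h1]] := strong_subreg_bound _ _ _ _ _ _ _ isoF kF.
have [r2 [r20 h2]] := calm_fun_bound _ _ _ _ _ _ gc lg.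
have k0 : 0 <= k by case: kF.
exists (Num.min (Num.min r1 r2) (Num.min delta zeta)); split.
  by rewrite !lt_min r10 r20 delta0.
move=> p x pr xr [_ -> [t Tt fpt0]].
have xr1 : cball xbar r1 x by apply: cball_le xr; rewrite !ge_min lexx.
have pr2 : cball pbar r2 p by apply: cball_le pr; rewrite !ge_min lexx orbT.
have xd : cball xbar delta x by apply: cball_le xr; rewrite !ge_min lexx !orbT.
have pz : cball pbar zeta p by apply: cball_le pr; rewrite !ge_min lexx !orbT.
have [_ [_ -> [a Aa <-]] [_ [b b1 <-] fpx]] := fA x p xd pz.
have /andP[rho0 rhoe] : 0 <= rho p (x - xbar) <= eps.
  apply: rhoP; exists (delta^-1 *: (x - xbar)); last first.
    by rewrite scalerA divff ?gt_eqF// scale1r.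
  rewrite /unit_cball /= normrZ ger0_norm ?invr_ge0 ?(ltW delta0)//.
  by rewrite mulrC ler_pdivrMr// mul1r; rewrite cball_normE in xd.
set w := (rho p (x - xbar) * _) *: b in fpx.
have wle : `|w| <= eps * `|x - xbar|.
  rewrite normrZ ger0_norm ?mulr_ge0// -[leRHS]mulr1.
  by apply: ler_pM => //; [exact: mulr_ge0|exact: ler_wpM2r].
have Fxz : F x (g pbar - g p - w).
  exists (g pbar + a); first by exists (g pbar) => //; exists a.
  exists t => //; move: fpt0; rewrite -fpx -/(g p) => /eqP.
  rewrite addr_eq0 => /eqP gE; rewrite -[t]opprK -gE.
  by rewrite !opprD addrA addrACA subrr addr0.
have dfin : edist (p, pbar) \is a fin_num.
  by rewrite ge0_fin_numE ?edist_ge0// edist_sym (le_lt_trans pz)// ltey.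
have := h1 x _ xr1 Fxz; have := h2 p pr2.
rewrite -(fineK dfin) !edist_normE subr0 -!EFinM !lee_fin -[g p - _]opprB normrN.
set d := fine _ => gl xk.
rewrite mulrAC ler_pdivlMr ?subr_gt0//.
have := ler_wpM2l k0 (le_trans (ler_normB (g pbar - g p) w) (lerD gl wle)).
move=> /(le_trans xk); set n := `|x - xbar|; lra.
Qed.

Theorem theorem8 (R : realType) (P : metricType R) (X Y : normedModType R)
    (f : P * X -> Y) (T : X -> set Y) (pbar : P) (xbar : X) (eps : R)
    (A : X -> set Y) :
  solution_map f T pbar xbar ->
  0 < eps ->
  calm_fun (fun p => f (p, xbar)) pbar ->
  {for pbar, continuous (fun p => f (p, xbar))} ->
  partial_outer_prederivative eps A f pbar xbar ->
  strongly_metrically_subregular (prederivative_map f A T pbar xbar) xbar 0 ->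
  (eps%:E * subreg (prederivative_map f A T pbar xbar) xbar 0%R < 1)%E ->
  isolated_calm (solution_map f T) pbar xbar /\
  (clm (solution_map f T) pbar xbar <=
     (clm_fun (fun p => f (p, xbar)) pbar
        * subreg (prederivative_map f A T pbar xbar) xbar 0%R)
     / (1 - eps%:E * subreg (prederivative_map f A T pbar xbar) xbar 0%R))%E.
Proof.
move=> xS eps0 [_ [l0 lg]] gc pre [[_ [k0 kF]] isoF].
set F := prederivative_map f A T pbar xbar in kF isoF *.
rewrite /subreg /clm_fun /clm.
set K := subreg_constant F xbar 0; set L := calm_constant _ pbar (f _).
have {kF lg} [Kk0 Ll0] : K k0 /\ L l0 by split.
have [-> s0] : ereal_inf [set k%:E | k in K] = (inf K)%:E /\ 0 <= inf K.
  by apply: ereal_inf_EFin_ge0; [exists k0|move=> k []].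
have [-> c0] : ereal_inf [set l%:E | l in L] = (inf L)%:E /\ 0 <= inf L.
  by apply: ereal_inf_EFin_ge0; [exists l0|move=> l []].
rewrite -EFinM lte_fin => es.
have es0 : 0 < 1 - eps * inf K by rewrite subr_gt0.
have calmS k l : K k -> L l -> eps * k < 1 ->
    calm_constant (solution_map f T) pbar xbar (k * l / (1 - eps * k)) /\
    isolated (solution_map f T pbar) xbar.
  move=> Kk Ll ek.
  have [r [r0 h]] := solution_bound _ _ _ _ _ _ _ _ _ _ _ _ gc Ll pre isoF Kk ek.
  apply: calm_isolated_of_bound xS _ r0 h.
  by rewrite divr_ge0 ?mulr_ge0 ?subr_ge0 ?(ltW ek)//; [case: Kk|case: Ll].
have [k1 Kk1 ek1] : exists2 k, K k & eps * k < 1.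
  have /inf_lt[] : inf K < eps^-1 by rewrite -[ltRHS]mul1r ltr_pdivlMr// mulrC.
    by exists k0.
  by move=> k Kk kl; exists k => //; rewrite mulrC -ltr_pdivlMr// mul1r.
have [calm1 iso1] := calmS k1 l0 Kk1 Ll0 ek1.
split; first by split=> //; split=> //; eexists; exact: calm1.
set C := calm_constant _ pbar xbar.
have [-> C0] : ereal_inf [set c%:E | c in C] = (inf C)%:E /\ 0 <= inf C.
  by apply: ereal_inf_EFin_ge0; [eexists; exact: calm1|move=> c []].
rewrite -EFinB inver gt_eqF// -!EFinM lee_fin ler_pdivlMr//.
(* For eps * k >= 1 the bound holds since eps * k * inf C is already at least
   inf C; the infimum can thus range over all of K. *)
have CKL k l : K k -> L l -> inf C <= k * (l + eps * inf C).
  move=> Kk Ll; have [k_ge0 l_ge0] : 0 <= k /\ 0 <= l by case: Kk; case: Ll.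
  have [ek|ek] := ltP (eps * k) 1; last first.
    have := ler_wpM2r C0 ek; have := mulr_ge0 k_ge0 l_ge0; lra.
  have : inf C <= k * l / (1 - eps * k).
    by apply: ge_inf; [exists 0 => c []|exact: (calmS k l Kk Ll ek).1].
  by rewrite ler_pdivlMr ?subr_gt0//; lra.
(* Infimum over l; inside it, for fixed l, infimum over k. *)
rewrite mulrC [leRHS]mulrC; apply: le_mul_inf; [by exists l0|by []|move=> l Ll].
have : inf C <= (l + eps * inf C) * inf K.
  apply: le_mul_inf; first by exists k0.
    by rewrite addr_ge0 ?mulr_ge0 ?(ltW eps0)//; case: Ll.
  by move=> k Kk; rewrite mulrC; exact: CKL.
lra.
Qed.
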